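(* Let $(X,\circ)$ be a group, $Y\subseteq X$, and, for all $a,b\in X$, $z_i,z_j\in Y$, let $\sigma_a^{z_{ij}},\tau_b^{z_{ij}}:X\to X$ be maps such that $\sigma_a^{z_{ij}}$ is a bijection and $$a\circ b=\sigma_a^{z_{ij}}(b)\circ\tau_b^{z_{ij}}(a)\quad\text{and}\quad\sigma^{z_{ji}}_{\sigma_a^{z_{ij}}(b)}\big(\tau_b^{z_{ij}}(a)\big)=a.$$ Moreover, define $\bullet_{z_{ij}}:X\times X\to X$ by $a\bullet_{z_{ji}}b:=a\circ(\sigma_a^{z_{ij}})^{-1}(b)\circ h(z_{ij})$ for all $a,b\in X$, $z_i,z_j\in Y$, where $h:Y\times Y\to Y$ is a symmetric function. (1) Then $a\bullet_{z_{ji}}b=b\bullet_{z_{ij}}a$ for all $a,b\in X$ and $z_i,z_j\in Y$. (2) Assume also that $(X,+,\circ)$ is a brace, $Y\subseteq\mathcal{D}(X)$, and $z_i\circ z_j=z_j\circ z_i$ for all $z_i,z_j\in Y$. If, for all $a,b\in X$ and $z_i,z_j\in Y$, $a\bullet_{z_{ij}}b=a\circ z_i+b\circ z_j$ and $h(z_{ij})=z_i\circ z_j$, then for all $a,b,c\in X$ and $z_i,z_j,z_k\in Y$: (a) $\sigma_a^{z_{ij}}(b)=z_i^{-1}-a\circ z_i^{-1}\circ z_j+a\circ b\circ z_j$; (b) $\sigma_a^{z_{ik}}\big(\sigma_b^{z_{ij}}(c)\big)=\sigma^{z_{ij}}_{\sigma_a^{z_{jk}}(b)}\Big(\sigma^{z_{ik}}_{\tau_b^{z_{jk}}(a)}(c)\Big)$,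 i.e. $\sigma_a^{z_{ij}}$ provides an admissible twist (for the trivial $p$-shelf).
   Context: $z_{ij}$ denotes dependence on the ordered pair $(z_i,z_j)\in Y\times Y$. A map $h:Y\times Y\to Y$, $(z_i,z_j)\mapsto h(z_{ij})$, is symmetric if $h(z_{ij})=h(z_{ji})$ for all $z_i,z_j\in Y$. In part (2), where $h(z_{ij})=z_i\circ z_j$, it is understood that $z_i\circ z_j\in Y$. A brace (left brace) is a set $X$ with group operations $+,\circ$, with $(X,+)$ abelian, such that $a\circ(b+c)=a\circ b-a+a\circ c$ for all $a,b,c$; $a^{-1}$ denotes the inverse in $(X,\circ)$. Its right distributor is $\mathcal{D}(X)=\{z\in X\mid (a+b)\circ z=a\circ z-z+b\circ z\ \ \forall a,b\in X\}$. Admissible twist: for a $p$-shelf $(X,\triangleright_{z_{ij}})$ (i.e. $a\triangleright_{z_{ik}}(b\triangleright_{z_{jk}}c)=(a\triangleright_{z_{ij}}b)\triangleright_{z_{jk}}(a\triangleright_{z_{ik}}c)$ always), a map $\varphi^{z_{ij}}(a,b)=(a,\sigma_a^{z_{ji}}(b))$ on $X\times X$ with all $\sigma_a^{z_{ij}}$ bijective is an admissible twist if for all $a,b,c\in X$, $z_i,z_j,z_k\in Y$: (1) $\sigma_a^{z_{ik}}(\sigma_b^{z_{ij}}(c))=\sigma^{z_{ij}}_{\sigma_a^{z_{jk}}(b)}(\sigma^{z_{ik}}_{\tau_b^{z_{jk}}(a)}(c))$, where $\tau_b^{z_{ij}}(a)=(\sigma^{z_{ji}}_{\sigma_a^{z_{ij}}(b)})^{-1}(\sigma_a^{z_{ij}}(b)\triangleright_{z_{ij}}a)$,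 and (2) $\sigma_c^{z_{ik}}(b)\triangleright_{z_{ij}}\sigma_c^{z_{jk}}(a)=\sigma_c^{z_{jk}}(b\triangleright_{z_{ij}}a)$. The trivial $p$-shelf is $a\triangleright_{z_{ij}}b=b$. *)

(* Defs.v *)
From HB Require Import structures.
From mathcomp Require Import all_boot all_order all_algebra.
From mathcomp Require Import mathcomp_extra boolp classical_sets functions.

Set Implicit Arguments.
Unset Strict Implicit.
Unset Printing Implicit Defensive.

(* A brace carries two groups on one carrier: [+], [-] are the zmodType
   operations; the multiplicative group operations are written [\circ] and
   [^-1%g] (a bare [^-1] below [+] would be the inverse of a unit ring). *)
Notation "a \circ b" := (a * b)%g
  (at level 40, left associativity) : group_scope.
Local Open Scope classical_set_scope.
Local Open Scope ring_scope.
Local Open Scope group_scope.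

HB.mixin Record Zmodule_Group_isBrace X of GRing.Zmodule X & Group X := {
  brace_distr : forall a b c : X,
    a \circ (b + c) = a \circ b - a + a \circ c
}.

#[short(type="braceType")]
HB.structure Definition Brace :=
  {X of GRing.Zmodule X & Group X & Zmodule_Group_isBrace X}.

Definition right_distributor (X : braceType) : set X :=
  [set z | forall a b : X, (a + b) \circ z = a \circ z - z + b \circ z].

(* The inverse of a bijection f : X -> X (for other f, [y] is sent to some
   preimage if it has one, and to itself otherwise). *)
Definition inverse (X : choiceType) (f : X -> X) : X -> X :=
  'pinv_id [set: X] f.

(* Throughout, a family of maps depending on z_ij takes z_i and z_j, in this
   order, as its first two arguments: sigma_a^{z_ij}(b) is [sigma zi zj a b] and
   tau_b^{z_ij}(a) is [tau zi zj b a]. *)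

Definition p_shelf (I X : Type) (tri : I -> I -> X -> X -> X) : Prop :=
  forall (a b c : X) (zi zj zk : I),
    tri zi zk a (tri zj zk b c) = tri zj zk (tri zi zj a b) (tri zi zk a c).

Definition trivial_shelf (I X : Type) : I -> I -> X -> X -> X :=
  fun _ _ _ b => b.

Definition twist_map (I X : Type) (sigma : I -> I -> X -> X -> X)
  (zi zj : I) (ab : X * X) : X * X := (ab.1, sigma zj zi ab.1 ab.2).

Definition shelf_tau (I : Type) (X : choiceType)
    (tri sigma : I -> I -> X -> X -> X) (zi zj : I) (b a : X) : X :=
  inverse (sigma zj zi (sigma zi zj a b)) (tri zi zj (sigma zi zj a b) a).

Definition admissible_twist (I : Type) (X : choiceType)
    (tri : I -> I -> X -> X -> X) (phi : I -> I -> X * X -> X * X) : Prop :=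
  p_shelf tri /\
  exists sigma : I -> I -> X -> X -> X,
    let tau := shelf_tau tri sigma in
    [/\ forall zi zj ab, phi zi zj ab = twist_map sigma zi zj ab,
        forall zi zj a, bijective (sigma zi zj a),
        forall a b c zi zj zk,
          sigma zi zk a (sigma zi zj b c) =
          sigma zi zj (sigma zj zk a b) (sigma zi zk (tau zj zk b a) c) &
        forall a b c zi zj zk,
          tri zi zj (sigma zi zk c b) (sigma zj zk c a) =
          sigma zj zk c (tri zi zj b a)].

Definition sigma_tau_family (X : groupType) (I : Type)
    (sigma tau : I -> I -> X -> X -> X) : Prop :=
  [/\ forall zi zj a, bijective (sigma zi zj a),
      forall a b zi zj, a \circ b = sigma zi zj a b \circ tau zi zj b a &
      forall a b zi zj, sigma zj zi (sigma zi zj a b) (tau zi zj b a) = a].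

(* [bullet sigma h zj zi a b] is the product of a and b indexed by z_ji; it is
   defined through sigma and h at z_ij. *)
Definition bullet (X : groupType) (Y : set X)
    (sigma : Y -> Y -> X -> X -> X) (h : Y -> Y -> Y) (zj zi : Y)
    (a b : X) : X :=
  a \circ inverse (sigma zi zj a) b \circ val (h zi zj).

(* Main.v *)
(* With y the preimage of b under sigma_a, the two hypotheses on (sigma, tau) say
   a o y = b o tau_y(a) and tau_y(a) = sigma_b^{-1}(a), which is (1). In (2),
   the formula for the product reads a o b o z_i o z_j = a o z_j + sigma_a(b) o z_i,
   and (a) is this equation solved for sigma_a(b). A composite
   sigma_a^{z_ik} sigma_b^{z_ij} then depends on a and b only through a o b and is
   symmetric in z_j and z_k, so (b) follows from a o b = sigma_a(b) o tau_b(a). *)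
Require Import Defs.
From HB Require Import structures.
From mathcomp Require Import all_boot all_order all_algebra.
From mathcomp Require Import mathcomp_extra boolp classical_sets functions.

Set Implicit Arguments.
Unset Strict Implicit.
Unset Printing Implicit Defensive.

Import GRing.Theory.

Local Open Scope classical_set_scope.
Local Open Scope ring_scope.
Local Open Scope group_scope.

Lemma inverseK (X : choiceType) (f : X -> X) :
  bijective f -> cancel f (inverse f).
Proof.
by move=> /bij_inj injf x; apply: pinvKV; [move=> ? ? _ _ /injf | rewrite inE].
Qed.

Lemma inverseVK (X : choiceType) (f : X -> X) :
  bijective f -> cancel (inverse f) f.
Proof. by move=> bf y; case: (bf) => g _ gK; rewrite -(gK y) inverseK. Qed.

Section BraceTheory.
Variable X : braceType.
Implicit Types a b x y w z : X.

(** Left multiplication by [a] is an additive map plus the constant [a]; in x - y + w the constants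
    of the first two terms cancel and one survives on each side. The formula for sigma has this
    ternary shape. *)
Lemma brace_mulBD a x y w :
  a \circ (x - y + w) = a \circ x - a \circ y + a \circ w.
Proof.
have -> : a \circ x = a \circ (x - y) - a + a \circ y.
  by rewrite -brace_distr subrK.
by rewrite brace_distr addrK.
Qed.

Lemma brace_one : 1%g = 0%R :> X.
Proof.
(* Distributing [1] over 0 + 0 leaves 0 = -1 in the additive group. *)
have := brace_distr (1%g : X) 0 0.
by rewrite !mul1g addr0 add0r addr0 => /(congr1 -%R); rewrite opprK oppr0.
Qed.

(** Mirror image of [brace_mulBD]: membership in the right distributor makes right multiplication by
    [z] affine. *)
Lemma right_distributor_mulBD z x y w : right_distributor z ->
  (x - y + w) \circ z = x \circ z - y \circ z + w \circ z.
Proof.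
move=> Dz; have -> : x \circ z = (x - y) \circ z - z + y \circ z.
  by rewrite -Dz subrK.
by rewrite Dz addrK.
Qed.

End BraceTheory.

Lemma bullet_sym (X : groupType) (Y : set X)
    (sigma tau : Y -> Y -> X -> X -> X) (h : Y -> Y -> Y) :
    sigma_tau_family sigma tau ->
    (forall zi zj : Y, h zi zj = h zj zi) ->
  forall (a b : X) (zi zj : Y),
    bullet sigma h zj zi a b = bullet sigma h zi zj b a.
Proof.
case=> bij_sigma mulE sigma_tau h_sym a b zi zj; rewrite /bullet h_sym.
set y := inverse (sigma zi zj a) b.
have sigma_y : sigma zi zj a y = b by apply: inverseVK.
have -> : inverse (sigma zj zi b) a = tau zi zj y a.
  by apply: (canLR (inverseK _)) => //; rewrite -sigma_y sigma_tau.
by rewrite (mulE a y zi zj) sigma_y.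
Qed.

Section BraceSigma.
Variables (X : braceType) (Y : set X) (sigma : Y -> Y -> X -> X -> X).
Hypothesis YD : Y `<=` @right_distributor X.
Hypothesis Ycomm : forall zi zj : Y, commute (val zi) (val zj).

Let DY (z : Y) : right_distributor (val z).
Proof. exact/YD/set_valP. Qed.

Lemma sigma_of_bullet (h : Y -> Y -> Y) :
    (forall zi zj a, bijective (sigma zi zj a)) ->
    (forall (a b : X) (zi zj : Y),
      bullet sigma h zi zj a b = a \circ val zi + b \circ val zj) ->
    (forall zi zj : Y, val (h zi zj) = val zi \circ val zj) ->
  forall (a b : X) (zi zj : Y),
    sigma zi zj a b =
    (val zi)^-1%g - a \circ (val zi)^-1%g \circ val zj + a \circ b \circ val zj.
Proof.
move=> bij_sigma bulletE hE a b zi zj.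
(* The product at z_ji unfolds to sigma at z_ij, so this second argument cancels the inverse. *)
have := bulletE a (sigma zi zj a b) zj zi.
rewrite /bullet inverseK // hE => mulE.
(* Times z_i on the right, the leading inverse becomes the additive zero, the middle term becomes a
   o z_j by commutativity, and the claim is [mulE] rearranged. *)
apply: (mulIg (val zi)).
rewrite right_distributor_mulBD // mulVg brace_one sub0r.
rewrite -(mulgA (a \circ _)) -(Ycomm zi zj) mulgA mulgVK.
by rewrite -(mulgA (a \circ b)) -(Ycomm zi zj) mulE addKr.
Qed.

Hypothesis sigmaE : forall (a b : X) (zi zj : Y),
  sigma zi zj a b =
  (val zi)^-1%g - a \circ (val zi)^-1%g \circ val zj + a \circ b \circ val zj.

Lemma sigma_comp (a b c : X) (zi zj zk : Y) :
  sigma zi zk a (sigma zi zj b c) =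
  (val zi)^-1%g - a \circ b \circ (val zi)^-1%g \circ (val zj \circ val zk)
    + a \circ b \circ c \circ (val zj \circ val zk).
Proof.
rewrite !sigmaE brace_mulBD right_distributor_mulBD // !mulgA.
(* The inner leading term, multiplied out to a o z_i^{-1} o z_k, cancels the outer middle term. *)
by rewrite !addrA subrK.
Qed.

End BraceSigma.

(** For the trivial shelf the twist's own tau is the preimage of [a] under sigma^{z_ji} at
    sigma_a(b), which the second relation of the family identifies. *)
Lemma shelf_tau_trivial (X : groupType) (I : Type)
    (sigma tau : I -> I -> X -> X -> X) (zi zj : I) (a b : X) :
  sigma_tau_family sigma tau ->
  shelf_tau (@trivial_shelf I X) sigma zi zj b a = tau zi zj b a.
Proof.
by case=> bij_sigma _ sigma_tau; apply: (canLR (inverseK _)).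
Qed.

Theorem proposition3p12 :
  (forall (X : groupType) (Y : set X) (sigma tau : Y -> Y -> X -> X -> X)
      (h : Y -> Y -> Y),
    sigma_tau_family sigma tau ->
    (forall zi zj : Y, h zi zj = h zj zi) ->
    forall (a b : X) (zi zj : Y),
      bullet sigma h zj zi a b = bullet sigma h zi zj b a)
  /\
  (forall (X : braceType) (Y : set X) (sigma tau : Y -> Y -> X -> X -> X)
      (h : Y -> Y -> Y),
    sigma_tau_family sigma tau ->
    (forall zi zj : Y, h zi zj = h zj zi) ->
    Y `<=` @right_distributor X ->
    (forall zi zj : Y, val zi \circ val zj = val zj \circ val zi) ->
    (forall (a b : X) (zi zj : Y),
      bullet sigma h zi zj a b = a \circ val zi + b \circ val zj) ->
    (forall zi zj : Y, val (h zi zj) = val zi \circ val zj) ->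
    (forall (a b : X) (zi zj : Y),
      sigma zi zj a b =
      (val zi)^-1%g - a \circ (val zi)^-1%g \circ val zj + a \circ b \circ val zj)
    /\
    (forall (a b c : X) (zi zj zk : Y),
      sigma zi zk a (sigma zi zj b c) =
      sigma zi zj (sigma zj zk a b) (sigma zi zk (tau zj zk b a) c))
    /\
    admissible_twist (@trivial_shelf Y X) (twist_map sigma)).
Proof.
split=> [X Y sigma tau h|X Y sigma tau h st h_sym YD Ycomm bulletE hE].
  exact: bullet_sym.
have [bij_sigma mulE _] := st.
have sigmaE := sigma_of_bullet YD Ycomm bij_sigma bulletE hE.
have braid a b c zi zj zk : sigma zi zk a (sigma zi zj b c) =
    sigma zi zj (sigma zj zk a b) (sigma zi zk (tau zj zk b a) c).
  by rewrite !(sigma_comp YD sigmaE) -mulE (Ycomm zj zk).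
split=> //; split=> //; split=> //.
(* Compatibility with the trivial shelf holds by computation; only the braid relation remains. *)
exists sigma; split=> // a b c zi zj zk.
by rewrite (shelf_tau_trivial _ _ _ _ st).
Qed.
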